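(* Let $Q$ be a precoherent near prequantale and let $M$ be a multiplicative semilattice. (1) $\mathrm{Idl}(M)$ is a precoherent near prequantale under $\downarrow$-multiplication. (2) $\mathsf{K}(Q)$ is a multiplicative semilattice. (3) The map $M\to\mathsf{K}(\mathrm{Idl}(M))$, $x\mapsto\,\downarrow\! x$, is an isomorphism of ordered magmas. (4) The map $\mathrm{Idl}(\mathsf{K}(Q))\to Q$, $I\mapsto\bigvee I$, is an isomorphism of ordered magmas. (5) If $f:Q\to Q'$ is a morphism of precoherent near prequantales, then the map $\mathsf{K}(f):\mathsf{K}(Q)\to\mathsf{K}(Q')$ given by $\mathsf{K}(f)(x)=f(x)$ for all $x\in\mathsf{K}(Q)$ is a morphism of multiplicative semilattices. (6) If $g:M\to M'$ is a morphism of multiplicative semilattices, then the map $\mathrm{Idl}(g):\mathrm{Idl}(M)\to\mathrm{Idl}(M')$ given by $\mathrm{Idl}(g)(I)=\,\downarrow\!(g(I))$ for all $I\in\mathrm{Idl}(M)$ is a morphism of precoherent near prequantales. (7) The associations $\mathsf{K}$ and $\mathrm{Idl}$ are functorial and provide an equivalence of categories between the category of precoherent near prequantales and the category of multiplicative semilattices.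
   Context: An ordered magma is a set with a binary operation (written multiplicatively, not assumed associative, commutative or unital) and a partial order such that $x\le x'$ and $y\le y'$ imply $xy\le x'y'$; an isomorphism of ordered magmas is a magma isomorphism that is also a poset isomorphism. A near prequantale is an ordered magma $Q$ such that for every nonempty subset $X$ of $Q$, $\bigvee X$ exists and $a(\bigvee X)=\bigvee(aX)$, $(\bigvee X)a=\bigvee(Xa)$ for all $a\in Q$. A multiplicative semilattice is an ordered magma $M$ in which any two elements have a supremum and $a(x\vee y)=ax\vee ay$, $(x\vee y)a=xa\vee ya$ for all $a,x,y\in M$; a morphism of multiplicative semilattices is a magma homomorphism $g$ with $g(\bigvee X)=\bigvee g(X)$ for all finite nonempty $X$. A directed subset of a poset is a nonempty subset $\Delta$ such that every finite subset of $\Delta$ has an upper bound in $\Delta$. An element $x$ of a poset $S$ is compact if whenever $x\le\bigvee\Delta$ for a directed $\Delta\subset S$ whose supremum exists, one has $x\le y$ for some $y\in\Delta$; $\mathsf{K}(S)$ is the set of compact elements of $S$. An ordered magma is precoherent if every element is a supremum of a set of compact elements and its set of compact elements is closed under multiplication; then $\mathsf{K}(Q)$ carries the induced order and multiplication. A morphism of precoherent near prequantales is a magma homomorphism $f:Q\to Q'$ with $f(\bigvee X)=\bigvee f(X)$ for all nonempty $X\subset Q$ and $f(\mathsf{K}(Q))\subset\mathsf{K}(Q')$. An ideal of a poset is a directed downward closed subset; $\mathrm{Idl}(S)$ is the set of all ideals of $S$ ordered by inclusion; $\downarrow\! x=\{y: y\le x\}$. For a nonempty subset $X$ of a join semilattice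 $S$, $\downarrow\! X=\{y\in S: y\le\bigvee T\text{ for some finite nonempty }T\subset X\}$ (the smallest ideal containing $X$). For a multiplicative semilattice $M$, $\downarrow$-multiplication on $\mathrm{Idl}(M)$ is $(I,J)\mapsto\,\downarrow\!(IJ)$, where $IJ=\{xy:x\in I,y\in J\}$. *)

(* Defs.v *)
From HB Require Import structures.
From mathcomp Require Import all_boot all_order.
From mathcomp Require Import boolp classical_sets functions cardinality.

Set Implicit Arguments.
Unset Strict Implicit.
Unset Printing Implicit Defensive.

Import Order.TTheory.

Local Open Scope classical_set_scope.
Local Open Scope order_scope.
Local Open Scope group_scope.

HB.mixin Record isOrderedMagma (d : Order.disp_t) T
    of Order.POrder d T & Magma T := {
  le_mulg : forall x x' y y' : T, x <= x' -> y <= y' -> x * y <= x' * y'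
}.

(* The display d only steers notations; it carries no mathematical content. *)
#[short(type="omagmaType")]
HB.structure Definition OrderedMagma (d : Order.disp_t) :=
  {T of Order.POrder d T & Magma T & isOrderedMagma d T}.

Definition omagma_isomorphism (d d' : Order.disp_t)
    (S : omagmaType d) (T : omagmaType d') (f : S -> T) : Prop :=
  [/\ bijective f, {morph f : x y / x * y} & {mono f : x y / x <= y}].

Section Posets.
Variables (d : Order.disp_t) (S : porderType d).

Definition directed (D : set S) : Prop :=
  D !=set0 /\
  forall F : set S, finite_set F -> F `<=` D -> exists2 u, D u & ubound F u.

Definition compact_elt : set S :=
  [set x | forall (D : set S) (s : S), directed D -> isLub D s -> x <= s ->
           exists2 y, D y & x <= y].

Definition ideal : set (set S) :=
  [set I | directed I /\ forall x y, I x -> y <= x -> I y].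

(* The downarrow of a nonempty subset X of a join semilattice, where every
   finite nonempty T has a least upper bound. *)
Definition ideal_hull (X : set S) : set S :=
  [set y | exists T t,
     [/\ finite_set T, T !=set0, T `<=` X, isLub T t & y <= t]].

End Posets.

Section Properties.
Variable d : Order.disp_t.

(* Since suprema are unique, "\bigvee X exists and a(\bigvee X) = \bigvee(aX)"
   is the existence of a least upper bound s of X such that a * s is a least
   upper bound of aX. *)
Definition near_prequantale (Q : omagmaType d) : Prop :=
  forall X : set Q, X !=set0 -> exists s, [/\ isLub X s,
    forall a, isLub [set a * x | x in X] (a * s)
  & forall a, isLub [set x * a | x in X] (s * a)].

Definition precoherent (Q : omagmaType d) : Prop :=
  (forall x : Q, exists2 X, X `<=` compact_elt (S := Q) & isLub X x) /\
  (forall x y : Q, compact_elt x -> compact_elt y -> compact_elt (x * y)).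

Definition multiplicative_semilattice (M : omagmaType d) : Prop :=
  forall x y : M, exists s, [/\ isLub [set x; y] s,
    forall a, isLub [set a * x; a * y] (a * s)
  & forall a, isLub [set x * a; y * a] (s * a)].

(* As finite nonempty suprema exist in M, g(\bigvee X) = \bigvee g(X) says that
   g maps the least upper bound of X to a least upper bound of g(X). *)
Definition msl_morphism (M M' : omagmaType d) (g : M -> M') : Prop :=
  {morph g : x y / x * y} /\
  forall (X : set M) (x : M), finite_set X -> X !=set0 ->
    isLub X x -> isLub (g @` X) (g x).

Definition pnq_morphism (Q Q' : omagmaType d) (f : Q -> Q') : Prop :=
  [/\ {morph f : x y / x * y},
      forall (X : set Q) (x : Q), X !=set0 ->
        isLub X x -> isLub (f @` X) (f x)
    & forall x, compact_elt x -> compact_elt (f x)].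

Record pnq := Pnq {
  pnq_sort :> omagmaType d;
  pnqP : near_prequantale pnq_sort /\ precoherent pnq_sort }.

Record msl := Msl {
  msl_sort :> omagmaType d;
  mslP : multiplicative_semilattice msl_sort }.

Record pnq_hom (Q Q' : pnq) := PnqHom {
  pnq_fun :> Q -> Q';
  pnq_funP : pnq_morphism pnq_fun }.

Record msl_hom (M M' : msl) := MslHom {
  msl_fun :> M -> M';
  msl_funP : msl_morphism msl_fun }.

End Properties.

Section CompactElements.
Variables (d : Order.disp_t) (Q : pnq d).

Definition K : Type := {x : Q | x \in compact_elt (S := Q)}.

HB.instance Definition _ := SubChoice.on K.
HB.instance Definition _ := [SubChoice_isSubPOrder of K by <: with d].

Fact K_mul_subproof (x y : K) : val x * val y \in compact_elt (S := Q).
Proof.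
case: (pnqP Q) => _ [_ cM]; apply/mem_set.
by apply: cM; apply: set_mem; exact: valP.
Qed.

Definition K_mul (x y : K) : K := Sub (val x * val y) (K_mul_subproof x y).

HB.instance Definition _ := hasMul.Build K K_mul.

Fact K_le_mulg (x x' y y' : K) : x <= x' -> y <= y' -> x * y <= x' * y'.
Proof. exact: le_mulg. Qed.

HB.instance Definition _ := isOrderedMagma.Build d K K_le_mulg.

End CompactElements.

Section Hull.
Variables (d : Order.disp_t).

Fact directed2 (S : porderType d) (D : set S) : D !=set0 ->
  (forall x y, D x -> D y -> exists u, [/\ D u, x <= u & y <= u]) -> directed D.
Proof.
move=> D0 D2; split=> // F /finite_seqP[s ->].
elim: s => [|a s IH] sD; first by case: D0 => u Du; exists u => // x.
have [x xs|u Du ubu] := IH; first by apply: sD; rewrite /= inE; apply/orP; right.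
have Da : D a by apply: sD; rewrite /= mem_head.
have [v [Dv av uv]] := D2 a u Da Du.
exists v => // x /=; rewrite inE => /predU1P[->//|xs].
by apply: le_trans uv; apply: ubu.
Qed.

Fact ideal_hull_ideal (M : msl d) (X : set M) :
  X !=set0 -> ideal (ideal_hull X).
Proof.
case=> x0 Xx0; split.
  apply: directed2.
    exists x0, [set x0], x0; split=> //.
    - by exists x0.
    - by move=> _ ->.
    - by split=> [_ ->//|b ub]; apply: ub.
  move=> y1 y2 [T1 [t1 [fT1 [z1 T1z] T1X [ub1 lb1] le1]]].
  move=> [T2 [t2 [fT2 _ T2X [ub2 lb2] le2]]].
  have [t [[ubt lbt] _ _]] := mslP t1 t2.
  have t1t : t1 <= t by apply: ubt; left.
  have t2t : t2 <= t by apply: ubt; right.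
  exists t; split; [|exact: le_trans t1t|exact: le_trans t2t].
  exists (T1 `|` T2), t; split=> //.
  - by rewrite finite_setU.
  - by exists z1; left.
  - by move=> z [/T1X|/T2X].
  - split=> [z [/ub1 zt|/ub2 zt]|b ubb].
    + exact: le_trans t1t.
    + exact: le_trans t2t.
    + apply: lbt => _ [->|->]; [apply: lb1|apply: lb2] => z Tz; apply: ubb.
        by left.
      by right.
move=> x y [T [t [fT T0 TX lt xt]]] yx; exists T, t; split=> //.
exact: le_trans xt.
Qed.

Fact ideal_hullS (S : porderType d) (X Y : set S) :
  X `<=` Y -> ideal_hull X `<=` ideal_hull Y.
Proof.
move=> XY y [T [t [fT T0 TX lt yt]]]; exists T, t; split=> //.
exact: subset_trans XY.
Qed.

End Hull.

Section Ideals.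
Variables (d : Order.disp_t) (M : msl d).

Definition Idl : Type := {I : set M | I \in ideal (S := M)}.

HB.instance Definition _ := SubChoice.on Idl.
(* The order inherited from set M is inclusion. *)
HB.instance Definition _ := [SubChoice_isSubPOrder of Idl by <: with d].

Definition hull_Idl (X : set M) (X0 : X !=set0) : Idl :=
  Sub (ideal_hull X) (mem_set (ideal_hull_ideal X0)).

Fact Idl_nonempty (I : Idl) : val I !=set0.
Proof. by have /set_mem[[]] := valP I. Qed.

Fact Idl_mul_subproof (I J : Idl) :
  [set x * y | x in val I & y in val J] !=set0.
Proof.
have [x Ix] := Idl_nonempty I; have [y Jy] := Idl_nonempty J.
by exists (x * y), x => //; exists y.
Qed.

Definition Idl_mul (I J : Idl) : Idl := hull_Idl (Idl_mul_subproof I J).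

HB.instance Definition _ := hasMul.Build Idl Idl_mul.

Fact Idl_le_mulg (I I' J J' : Idl) : I <= I' -> J <= J' -> I * J <= I' * J'.
Proof.
move=> /subsetPset II' /subsetPset JJ'; apply/subsetPset; apply: ideal_hullS.
move=> _ [x Ix [y Jy <-]]; exists x; first exact: II'.
by exists y => //; exact: JJ'.
Qed.

HB.instance Definition _ := isOrderedMagma.Build d Idl Idl_le_mulg.

End Ideals.

Section Maps.
Variable d : Order.disp_t.

Fact K_map_subproof (Q Q' : pnq d) (f : pnq_hom Q Q') (x : K Q) :
  f (val x) \in compact_elt (S := Q').
Proof.
case: (pnq_funP f) => _ _ fK; apply/mem_set; apply: fK; apply: set_mem.
exact: valP.
Qed.

Definition K_map (Q Q' : pnq d) (f : pnq_hom Q Q') (x : K Q) : K Q' :=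
  Sub (f (val x)) (K_map_subproof f x).

Fact Idl_map_subproof (M M' : msl d) (g : msl_hom M M') (I : Idl M) :
  g @` val I !=set0.
Proof. exact/image_nonempty/Idl_nonempty. Qed.

Definition Idl_map (M M' : msl d) (g : msl_hom M M') (I : Idl M) : Idl M' :=
  hull_Idl (Idl_map_subproof g I).

End Maps.

Record category := Category {
  obj :> Type;
  hom : obj -> obj -> Type;
  idm : forall a, hom a a;
  comp : forall a b c, hom b c -> hom a b -> hom a c;
  comp1m : forall a b (f : hom a b), comp (idm b) f = f;
  compm1 : forall a b (f : hom a b), comp f (idm a) = f;
  compA : forall a b c e (h : hom c e) (g : hom b c) (f : hom a b),
    comp h (comp g f) = comp (comp h g) f }.

Arguments hom {c0} a b : rename.
Arguments idm {c0} a : rename.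
Arguments comp {c0 a b c} g f : rename.

Definition is_functor (C D : category) (F0 : C -> D)
    (F1 : forall a b : C, hom a b -> hom (F0 a) (F0 b)) : Prop :=
  (forall a, F1 a a (idm a) = idm (F0 a)) /\
  (forall (a b c : C) (g : hom b c) (f : hom a b),
     F1 a c (comp g f) = comp (F1 b c g) (F1 a b f)).

Record functor (C D : category) := Functor {
  fobj :> C -> D;
  fmap : forall a b : C, hom a b -> hom (fobj a) (fobj b);
  functorP : is_functor fmap }.

Arguments fmap {C D} F {a b} f : rename.

Section Functors.

Fact functor_id_subproof (C : category) :
  is_functor (F0 := fun a : C => a) (fun _ _ f => f).
Proof. by []. Qed.

Definition functor_id (C : category) : functor C C :=
  Functor (functor_id_subproof C).

Fact functor_comp_subproof (C D E : category)
    (G : functor D E) (F : functor C D) :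
  is_functor (fun a b (f : hom a b) => fmap G (fmap F f)).
Proof.
case: (functorP F) (functorP G) => F1 FM [G1 GM].
by split=> [a|a b c g f]; rewrite ?F1 ?FM ?G1 ?GM.
Qed.

Definition functor_comp (C D E : category)
    (G : functor D E) (F : functor C D) : functor C E :=
  Functor (functor_comp_subproof G F).

Definition isomorphism (C : category) (a b : C) (f : hom a b) : Prop :=
  exists g : hom b a, comp g f = idm a /\ comp f g = idm b.

Definition naturally_isomorphic (C D : category) (F G : functor C D) : Prop :=
  exists eta : forall a, hom (F a) (G a),
    (forall (a b : C) (f : hom a b),
       comp (eta b) (fmap F f) = comp (fmap G f) (eta a)) /\
    (forall a, isomorphism (eta a)).

Definition category_equivalence (C D : category)
    (F : functor C D) (G : functor D C) : Prop :=
  naturally_isomorphic (functor_comp G F) (functor_id C) /\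
  naturally_isomorphic (functor_comp F G) (functor_id D).

End Functors.

Section Categories.
Variable d : Order.disp_t.

Fact pnq_hom_eq (Q Q' : pnq d) (f g : pnq_hom Q Q') : f =1 g -> f = g.
Proof.
case: f g => [f fP] [g gP] /= /funext fg; subst g.
by rewrite (Prop_irrelevance fP gP).
Qed.

Fact msl_hom_eq (M M' : msl d) (f g : msl_hom M M') : f =1 g -> f = g.
Proof.
case: f g => [f fP] [g gP] /= /funext fg; subst g.
by rewrite (Prop_irrelevance fP gP).
Qed.

Fact pnq_id_subproof (Q : pnq d) : pnq_morphism (fun x : Q => x).
Proof. by split=> // X x _; rewrite image_id. Qed.

Definition pnq_id (Q : pnq d) : pnq_hom Q Q := PnqHom (pnq_id_subproof Q).

Fact pnq_comp_subproof (Q1 Q2 Q3 : pnq d)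
  (g : pnq_hom Q2 Q3) (f : pnq_hom Q1 Q2) : pnq_morphism (fun x => g (f x)).
Proof.
case: (pnq_funP f) (pnq_funP g) => fM fS fK [gM gS gK].
split=> [x y|X x X0 Xx|x /fK/gK//]; first by rewrite fM gM.
rewrite -(image_comp f g); apply: gS; first exact: image_nonempty.
exact: fS.
Qed.

Definition pnq_comp (Q1 Q2 Q3 : pnq d)
    (g : pnq_hom Q2 Q3) (f : pnq_hom Q1 Q2) : pnq_hom Q1 Q3 :=
  PnqHom (pnq_comp_subproof g f).

Fact msl_id_subproof (M : msl d) : msl_morphism (fun x : M => x).
Proof. by split=> // X x _ _; rewrite image_id. Qed.

Definition msl_id (M : msl d) : msl_hom M M := MslHom (msl_id_subproof M).

Fact msl_comp_subproof (M1 M2 M3 : msl d)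
  (g : msl_hom M2 M3) (f : msl_hom M1 M2) : msl_morphism (fun x => g (f x)).
Proof.
case: (msl_funP f) (msl_funP g) => fM fS [gM gS].
split=> [x y|X x finX X0 Xx]; first by rewrite fM gM.
rewrite -(image_comp f g); apply: gS.
- exact: finite_image.
- exact: image_nonempty.
- exact: fS.
Qed.

Definition msl_comp (M1 M2 M3 : msl d)
    (g : msl_hom M2 M3) (f : msl_hom M1 M2) : msl_hom M1 M3 :=
  MslHom (msl_comp_subproof g f).

Definition pnq_category : category.
Proof.
by refine (@Category (pnq d) (@pnq_hom d) pnq_id pnq_comp _ _ _);
  move=> *; apply: pnq_hom_eq.
Defined.

Definition msl_category : category.
Proof.
by refine (@Category (msl d) (@msl_hom d) msl_id msl_comp _ _ _);
  move=> *; apply: msl_hom_eq.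
Defined.

End Categories.

(* Main.v *)
(* Finite suprema control both sides of the equivalence.  Finite suprema of
   compact elements are compact, so those of K(Q) are computed in Q.  In Idl(M),
   the supremum of a family is the hull of its union, and the union itself when
   the family is directed; hence the compact ideals are exactly the principal
   ones.  An ideal is the same as a nonempty set closed under finite suprema and
   passage to smaller elements, a property inherited by preimages under maps
   preserving finite suprema; applied to translations of M and to morphisms
   M -> M', this reduces inclusions between hulls to inclusions between
   generators.  Finally, a compact k below sup I lies below an element of I
   because I is directed, so I is recovered from its supremum. *)

Require Import Defs.
From HB Require Import structures.
From mathcomp Require Import all_boot all_order.
From mathcomp Require Import boolp classical_sets functions cardinality.

Set Implicit Arguments.
Unset Strict Implicit.
Unset Printing Implicit Defensive.

Import Order.TTheory.

Local Open Scope classical_set_scope.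
Local Open Scope order_scope.

(** * Least upper bounds, ideals and compact elements in posets *)

Section PosetLemmas.
Variables (d : Order.disp_t) (S : porderType d).

Lemma isLub_unique (X : set S) (x y : S) : isLub X x -> isLub X y -> x = y.
Proof.
by move=> [ubx lex] [uby ley]; apply/le_anti; rewrite lex//= ley.
Qed.

Lemma isLub1 (x : S) : isLub [set x] x.
Proof. by split=> [_ ->//|b]; apply. Qed.

Lemma isLubU (X Y : set S) (x y z : S) :
  isLub X x -> isLub Y y -> isLub [set x; y] z -> isLub (X `|` Y) z.
Proof.
move=> [ubx lex] [uby ley] [ubz lez]; split=> [t [/ubx tx|/uby ty]|b ubb].
- by apply: le_trans tx _; apply: ubz; left.
- by apply: le_trans ty _; apply: ubz; right.
apply: lez => _ [->|->]; [apply: lex|apply: ley] => t Xt; apply: ubb.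
  by left.
by right.
Qed.

Lemma isLub2_le (x y : S) : x <= y -> isLub [set x; y] y.
Proof. by move=> xy; split=> [_ [->|->]//|b]; apply; right. Qed.

Lemma directed_bound2 (D : set S) (x y : S) : directed D -> D x -> D y ->
  exists u, [/\ D u, x <= u & y <= u].
Proof.
move=> [_ bD] Dx Dy; have [||u Du ubu] := bD [set x; y].
- exact: finite_set2.
- by move=> _ [->|->].
- by exists u; split=> //; apply: ubu; [left|right].
Qed.

(** Nonemptiness is left out so that the property passes to preimages, which may be empty. *)
Definition finlub_closed (A : set S) : Prop :=
  forall (T : set S) (t y : S), finite_set T -> T !=set0 -> T `<=` A ->
    isLub T t -> y <= t -> A y.

Lemma ideal_finlub_closed (I : set S) : ideal I -> finlub_closed I.
Proof.
move=> [[_ bI] dI] T t y finT T0 TI [_ let_] yt.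
have [u Iu ubu] := bI T finT TI.
by apply: dI Iu _; apply: le_trans yt _; apply: let_.
Qed.

(** Serves as an induction principle: a property closed under finite suprema and smaller elements is
    checked on generators only. *)
Lemma ideal_hull_min (X A : set S) :
  finlub_closed A -> X `<=` A -> ideal_hull X `<=` A.
Proof.
move=> cA XA y [T [t [finT T0 TX lubt yt]]].
by apply: cA lubt yt => //; apply: subset_trans XA.
Qed.

Lemma sub_ideal_hull (X : set S) : X `<=` ideal_hull X.
Proof.
move=> x Xx; exists [set x], x; split=> //; last exact: isLub1.
- by exists x.
- by move=> _ ->.
Qed.

Lemma ideal_down (x : S) : ideal [set y | y <= x].
Proof.
split=> [|y z /= yx zy]; last exact: le_trans yx.
apply: directed2; first by exists x; rewrite /= lexx.
by move=> y z /= yx zx; exists x.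
Qed.

Lemma down_finlub_closed (x : S) : finlub_closed [set y | y <= x].
Proof. exact: ideal_finlub_closed (ideal_down x). Qed.

(** Choose for each element of [T] a member of [D] above it, then bound the finite set of chosen
    members. *)
Lemma directed_cofinal (D T : set S) : directed D -> finite_set T ->
  (forall x, T x -> exists2 y, D y & x <= y) -> exists2 u, D u & ubound T u.
Proof.
move=> [_ bD] finT TD.
have [x|f fP] := @choice _ _ (fun x y => T x -> D y /\ x <= y).
  (* Outside [T] the value [x] is an arbitrary default. *)
  by have [/TD[y Dy xy]|nTx] := pselect (T x); [exists y|exists x].
have [||u Du ubu] := bD (f @` T); first exact: finite_image.
  by move=> _ [x /fP[Dfx _] <-].
exists u => // x Tx; have [_ xfx] := fP x Tx; apply: le_trans xfx _.
by apply: ubu; exists x.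
Qed.

(** Compactness puts each element of [T] below some member of [D]; directedness then gives a single
    member above all of [T], hence above [s]. *)
Lemma compact_elt_isLub (T : set S) (s : S) : finite_set T ->
  T `<=` compact_elt (S := S) -> isLub T s -> compact_elt s.
Proof.
move=> finT cT [ubs les] D u dirD lubu su.
have [x Tx|v Dv ubv] := directed_cofinal dirD finT.
  by apply: (cT x Tx D u dirD lubu); apply: le_trans su; apply: ubs.
by exists v => //; apply: les.
Qed.

(* If [X] is empty then [q] is a least element, which is compact because
   directed sets are nonempty. *)
Lemma isLub_compact_below (X : set S) (q : S) :
  X `<=` compact_elt (S := S) -> isLub X q ->
  [set k | compact_elt k /\ k <= q] !=set0 /\
  isLub [set k | compact_elt k /\ k <= q] q.
Proof.
move=> cX [ubq leq_]; split; last first.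
  split=> [k []//|b ubb]; apply: leq_ => x Xx.
  by apply: ubb; split; [apply: cX|apply: ubq].
have [[x Xx]|X0] := pselect (X !=set0).
  by exists x; split; [apply: cX|apply: ubq].
exists q; split=> // D u [[y Dy] _] _ _; exists y => //.
by apply: leq_ => x Xx; case: X0; exists x.
Qed.

End PosetLemmas.

(** * Maps preserving finite suprema *)

Section FiniteLubs.
Variables (d : Order.disp_t).

Definition finlub_preserving (S S' : porderType d) (g : S -> S') : Prop :=
  forall (X : set S) (x : S), finite_set X -> X !=set0 ->
    isLub X x -> isLub (g @` X) (g x).

Lemma finlub_preserving_homo (S S' : porderType d) (g : S -> S') :
  finlub_preserving g -> {homo g : x y / x <= y}.
Proof.
move=> gP x y xy; have [||ubgy _] := gP [set x; y] y _ _ (isLub2_le xy).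
- exact: finite_set2.
- by exists x; left.
by apply: ubgy; exists x => //; left.
Qed.

(** The image under [g] of a finite supremum is again a finite supremum, and [g] is monotone. *)
Lemma finlub_closed_preimage (S S' : porderType d) (g : S -> S') (A : set S') :
  finlub_preserving g -> finlub_closed A -> finlub_closed (g @^-1` A).
Proof.
move=> gP cA T t y finT T0 TA lubt yt.
apply: (cA (g @` T) (g t)); [exact: finite_image|exact: image_nonempty|..].
- by move=> _ [x /TA Ax <-].
- exact: gP.
- exact: finlub_preserving_homo yt.
Qed.

(** Induction on a list enumerating the finite set, adjoining one element at a time through the
    binary suprema of [M]. *)
Lemma finlub_preservingW (M : msl d) (S : porderType d) (g : M -> S) :
  (forall x y s, isLub [set x; y] s -> isLub [set g x; g y] (g s)) ->
  finlub_preserving g.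
Proof.
move=> gP X x /finite_seqP[[|a s] ->] [] //= z zs lubx.
(* By uniqueness of suprema, the induction may build its own supremum instead of decomposing [x]. *)
suff [t lubt lubgt] : exists2 t, isLub [set` a :: s] t &
    isLub (g @` [set` a :: s]) (g t) by rewrite (isLub_unique lubx lubt).
elim: s a {z zs x lubx} => [|b s IH] a.
  by exists a; rewrite set_cons1 ?image_set1; apply: isLub1.
have [t lubt lubgt] := IH b; have [u [lubu _ _]] := mslP a t.
have -> : [set` a :: b :: s] = [set a] `|` [set` b :: s].
  by apply/predeqP => z /=; rewrite in_cons; split=> /predU1P.
exists u; first exact: isLubU (isLub1 _) lubt lubu.
rewrite image_setU image_set1.
exact: isLubU (isLub1 _) lubgt (gP _ _ _ lubu).
Qed.

Lemma msl_mulgl_finlub (M : msl d) (a : M) :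
  finlub_preserving (fun x : M => (a * x)%g).
Proof.
apply: finlub_preservingW => x y s lubs.
by have [t [lubt /(_ a) + _]] := mslP x y; rewrite (isLub_unique lubs lubt).
Qed.

Lemma msl_mulgr_finlub (M : msl d) (a : M) :
  finlub_preserving (fun x : M => (x * a)%g).
Proof.
apply: finlub_preservingW => x y s lubs.
by have [t [lubt _ /(_ a)]] := mslP x y; rewrite (isLub_unique lubs lubt).
Qed.

(** Treat one factor at a time: translations preserve finite suprema, so preimages of [A] under them
    stay closed. *)
Lemma ideal_hull_mul_min (M : msl d) (X Y A : set M) : finlub_closed A ->
  (forall x y, X x -> Y y -> A (x * y)%g) ->
  forall x y, ideal_hull X x -> ideal_hull Y y -> A (x * y)%g.
Proof.
move=> cA XYA x y Xx Yy; move: x Xx; apply: ideal_hull_min.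
  exact: (finlub_closed_preimage (@msl_mulgr_finlub M y) cA).
move=> x Xx; move: y Yy; apply: ideal_hull_min.
  exact: (finlub_closed_preimage (@msl_mulgl_finlub M x) cA).
by move=> y Yy; apply: XYA.
Qed.

End FiniteLubs.

(** * Isomorphisms of ordered magmas and of objects in the two categories *)

Section Isomorphisms.
Local Open Scope group_scope.
Variables (d d' : Order.disp_t) (S : omagmaType d) (T : omagmaType d').
Variable f : S -> T.

(** Reflecting the order forces injectivity by antisymmetry, and choice turns surjectivity into an
    inverse. *)
Lemma omagma_isomorphism_surj : {morph f : x y / x * y} ->
  {mono f : x y / x <= y} -> (forall y, exists x, f x = y) ->
  omagma_isomorphism f.
Proof.
move=> fM fle /choice[g fgK]; split=> //; exists g => // x.
by apply: (inc_inj fle); rewrite fgK.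
Qed.

Lemma omagma_isomorphism_inv : omagma_isomorphism f ->
  exists g, [/\ cancel f g, cancel g f & omagma_isomorphism g].
Proof.
move=> [[g fgK gfK] fM fle]; exists g; split=> //; split; first by exists f.
- by move=> x y; apply: (can_inj fgK); rewrite fM !gfK.
- by move=> x y; rewrite -fle !gfK.
Qed.

Lemma omagma_isomorphism_isLub (X : set S) (x : S) : omagma_isomorphism f ->
  isLub X x -> isLub (f @` X) (f x).
Proof.
move=> [[g fgK gfK] _ fle] [ubx lex]; split=> [_ [y Xy <-]|b ubb].
  by rewrite fle; apply: ubx.
rewrite -(gfK b) fle; apply: lex => y Xy; rewrite -fle gfK.
by apply: ubb; exists y.
Qed.

End Isomorphisms.

(** The inverse carries directed sets and their suprema back to [S], where compactness of [x]
    applies. *)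
Lemma omagma_isomorphism_compact (d d' : Order.disp_t) (S : omagmaType d)
  (T : omagmaType d') (f : S -> T) (x : S) :
  omagma_isomorphism f -> compact_elt x -> compact_elt (f x).
Proof.
move=> fI cx D s dirD lubs; have [g [fgK gfK gI]] := omagma_isomorphism_inv fI.
have [_ _ fle] := fI; have [_ _ gle] := gI.
rewrite -{1}(gfK s) fle => xgs.
have [||y [z Dz <-] xz] := cx (g @` D) (g s) _ _ xgs.
- case: dirD => D0 bD; split=> [|F finF FD]; first exact: image_nonempty.
  have [||u Du ubu] := bD (f @` F); first exact: finite_image.
    by move=> _ [y /FD[z Dz <-] <-]; rewrite gfK.
  exists (g u); first by exists u.
  by move=> y Fy; rewrite -fle gfK; apply: ubu; exists y.
- exact: omagma_isomorphism_isLub.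
by exists z; rewrite // -(gfK z) fle.
Qed.

Section IsomorphismMorphisms.
Variable d : Order.disp_t.

Lemma omagma_isomorphism_pnq (Q Q' : pnq d) (f : Q -> Q') :
  omagma_isomorphism f -> pnq_morphism f.
Proof.
move=> fI; split=> [||x]; first by case: fI.
- by move=> X x _; apply: omagma_isomorphism_isLub.
- exact: omagma_isomorphism_compact.
Qed.

Lemma omagma_isomorphism_msl (M M' : msl d) (g : M -> M') :
  omagma_isomorphism g -> msl_morphism g.
Proof.
move=> gI; split; first by case: gI.
by move=> X x _ _; apply: omagma_isomorphism_isLub.
Qed.

Lemma pnq_isomorphism (Q Q' : pnq d) (f : pnq_hom Q Q') :
  omagma_isomorphism f -> isomorphism (C := pnq_category d) f.
Proof.
move=> /omagma_isomorphism_inv[g [fgK gfK gI]].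
by exists (PnqHom (omagma_isomorphism_pnq gI)); split; apply: pnq_hom_eq.
Qed.

Lemma msl_isomorphism (M M' : msl d) (g : msl_hom M M') :
  omagma_isomorphism g -> isomorphism (C := msl_category d) g.
Proof.
move=> /omagma_isomorphism_inv[f [gfK fgK fI]].
by exists (MslHom (omagma_isomorphism_msl fI)); split; apply: msl_hom_eq.
Qed.

End IsomorphismMorphisms.

(** The componentwise inverses are natural: compose the naturality square of [eta] with [inv] on
    both sides. *)
Lemma naturally_isomorphic_sym (C D : category) (F G : functor C D) :
  naturally_isomorphic F G -> naturally_isomorphic G F.
Proof.
move=> [eta [etaN etaI]]; pose inv a := sval (cid (etaI a)).
have etaK a : Defs.comp (inv a) (eta a) = idm (F a) := (svalP (cid (etaI a))).1.
have invK a : Defs.comp (eta a) (inv a) = idm (G a) := (svalP (cid (etaI a))).2.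
exists inv; split=> [a b f|a]; last by exists (eta a).
rewrite -[LHS]compm1 -(invK a) Defs.compA -(Defs.compA (inv b)) -etaN.
by rewrite (Defs.compA (inv b)) etaK comp1m.
Qed.

(** * The ideals of a multiplicative semilattice *)

Section IdealTheory.
Local Open Scope group_scope.
Variables (d : Order.disp_t) (M : msl d).
Implicit Types (I J : Idl M) (X D : set (Idl M)).

Lemma Idl_ideal I : ideal (val I).
Proof. exact: set_mem (valP I). Qed.

Lemma Idl_finlub_closed I : finlub_closed (val I).
Proof. exact: ideal_finlub_closed (Idl_ideal I). Qed.

Lemma Idl_leP I J : reflect (val I `<=` val J) (I <= J).
Proof. exact: subsetPset. Qed.

Lemma Idl_bigcup_nonempty X : X !=set0 -> \bigcup_(I in X) val I !=set0.
Proof. by case=> I XI; have [x Ix] := Idl_nonempty I; exists x, I. Qed.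

Lemma isLub_Idl X (X0 : X !=set0) :
  isLub X (hull_Idl (Idl_bigcup_nonempty X0)).
Proof.
split=> [I XI|J ubJ]; apply/Idl_leP => /=.
  by move=> x Ix; apply: sub_ideal_hull; exists I.
apply: ideal_hull_min; first exact: Idl_finlub_closed.
by move=> x [I /ubJ /Idl_leP IJ Ix]; apply: IJ.
Qed.

Lemma isLub_IdlE X J : X !=set0 -> isLub X J ->
  val J = ideal_hull (\bigcup_(I in X) val I).
Proof. by move=> X0 /(isLub_unique (isLub_Idl X0)) <-. Qed.

(** Finitely many elements of the union lie in finitely many members of [D], hence in a common
    larger member, which also contains their supremum. The union is thus already closed. *)
Lemma isLub_Idl_directed D J : directed D -> isLub D J ->
  val J = \bigcup_(I in D) val I.
Proof.
move=> dirD lubJ; apply/seteqP; split; last first.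
  by move=> x [I DI Ix]; have /Idl_leP := lubJ.1 I DI; apply.
rewrite (isLub_IdlE dirD.1 lubJ); apply: ideal_hull_min => // T t y finT T0 TD.
have [x|f fP] := @choice _ _ (fun x I => T x -> D I /\ val I x).
  have [/TD[I DI Ix]|nTx] := pselect (T x); first by exists I.
  by have [[I _] _] := dirD; exists I.
move=> lubt yt; have [||I DI ubI] := dirD.2 (f @` T); first exact: finite_image.
  by move=> _ [x /fP[Dfx _] <-].
exists I => //; apply: (Idl_finlub_closed finT T0 _ lubt yt) => x Tx.
have [_ fx] := fP x Tx.
have /Idl_leP : f x <= I by apply: ubI; exists x.
exact.
Qed.

(** Universal property of the product; it allows work with elementwise products rather than
    hulls. *)
Lemma Idl_mul_leP I J (L : Idl M) :
  reflect (forall x y, val I x -> val J y -> val L (x * y)) (I * J <= L).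
Proof.
apply: (iffP (Idl_leP _ _)) => IJL => [x y Ix Jy|].
  by apply/IJL/sub_ideal_hull; exists x => //; exists y.
apply: ideal_hull_min; first exact: Idl_finlub_closed.
by move=> _ [x Ix [y Jy <-]]; apply: IJL.
Qed.

Lemma Idl_near_prequantale : near_prequantale (Idl M).
Proof.
move=> X X0; have lubX := isLub_Idl X0.
exists (hull_Idl (Idl_bigcup_nonempty X0)); split=> // A; split.
- by move=> _ [I XI <-]; apply: le_mulg => //; apply: lubX.1.
(* For fixed [x], the elements [y] with [x * y] in [B] are closed under finite suprema, so only [y]
   in some member of [X] need be checked. *)
- move=> B ubB; apply/Idl_mul_leP => x y Ax; move: y; apply: ideal_hull_min.
    exact: finlub_closed_preimage (@msl_mulgl_finlub _ _ x)
      (@Idl_finlub_closed B).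
  move=> y [I XI Iy]; have /Idl_mul_leP : A * I <= B by apply: ubB; exists I.
  exact.
- by move=> _ [I XI <-]; apply: le_mulg => //; apply: lubX.1.
- move=> B ubB; apply/Idl_mul_leP => x y + Ay; move: x; apply: ideal_hull_min.
    exact: finlub_closed_preimage (@msl_mulgr_finlub _ _ y)
      (@Idl_finlub_closed B).
  move=> x [I XI Ix]; have /Idl_mul_leP : I * A <= B by apply: ubB; exists I.
  exact.
Qed.

Definition down (x : M) : Idl M :=
  Sub [set y | y <= x] (mem_set (ideal_down x)).

Lemma down_leP (x : M) I : reflect (val I x) (down x <= I).
Proof.
apply: (iffP (Idl_leP _ _)) => [|Ix y /= yx]; first by apply; rewrite /= lexx.
exact: (Idl_ideal I).2 yx.
Qed.

Lemma le_down : {mono down : x y / x <= y}.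
Proof. by move=> x y; apply/down_leP/idP. Qed.

Lemma downM : {morph down : x y / x * y}.
Proof.
move=> x y; apply/le_anti/andP; split; last first.
  by apply/Idl_mul_leP => u v /= ux vy; apply: le_mulg.
by apply/down_leP/sub_ideal_hull; exists x; [|exists y]; rewrite /= ?lexx.
Qed.

(** A directed supremum of ideals is their union, so [x] already belongs to one of them. *)
Lemma compact_down (x : M) : compact_elt (down x).
Proof.
move=> D J dirD lubJ /down_leP; rewrite (isLub_Idl_directed dirD lubJ).
by move=> [I DI Ix]; exists I => //; apply/down_leP.
Qed.

Lemma isLub_down I : isLub (down @` val I) I.
Proof.
split=> [_ [x Ix <-]|J ubJ]; first exact/down_leP.
by apply/Idl_leP => x Ix; apply/down_leP/ubJ; exists x.
Qed.

(** An ideal is the directed supremum of the principal ideals of its elements; compactness puts it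
    inside one of these. *)
Lemma compact_Idl_down I : compact_elt I -> exists x, I = down x.
Proof.
move=> cI; have [||_ [x Ix <-] Ile] := cI (down @` val I) I _ (isLub_down I).
- apply: directed2; first exact/image_nonempty/Idl_nonempty.
  move=> _ _ [x Ix <-] [y Iy <-].
  have [u [Iu xu yu]] := directed_bound2 (Idl_ideal I).1 Ix Iy.
  by exists (down u); rewrite !le_down; split=> //; exists u.
- exact: lexx.
by exists x; apply/le_anti; rewrite Ile; apply/down_leP.
Qed.

Lemma Idl_precoherent : precoherent (Idl M).
Proof.
split=> [I|I J /compact_Idl_down[x ->] /compact_Idl_down[y ->]]; last first.
  by rewrite -downM; apply: compact_down.
exists (down @` val I); last exact: isLub_down.
by move=> _ [x _ <-]; apply: compact_down.
Qed.

Lemma Idl_pnq : near_prequantale (Idl M) /\ precoherent (Idl M).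
Proof. exact: conj Idl_near_prequantale Idl_precoherent. Qed.

Definition down_K (x : M) : K (Pnq Idl_pnq) :=
  Sub (down x : Pnq Idl_pnq) (mem_set (@compact_down x)).

Lemma down_K_isomorphism : omagma_isomorphism down_K.
Proof.
apply: omagma_isomorphism_surj => [x y|x y|u].
- by apply/val_inj/downM.
- exact: le_down.
- have [x ux] := compact_Idl_down (set_mem (valP u)).
  by exists x; apply/val_inj; rewrite /= ux.
Qed.

End IdealTheory.

(** * The compact elements of a precoherent near prequantale *)

Section CompactTheory.
Local Open Scope group_scope.
Variables (d : Order.disp_t) (Q : pnq d).
Implicit Types (X : set (K Q)) (x y k : K Q) (q : Q).

Lemma K_compact k : compact_elt (val k).
Proof. exact: set_mem (valP k). Qed.

(** The order on [K Q] is induced, so suprema are reflected by the inclusion. Preservation is a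
    separate matter, settled next for finite sets. *)
Lemma isLub_K X k : isLub (val @` X) (val k) -> isLub X k.
Proof.
move=> [ubk lek]; split=> [x Xx|y uby].
  by apply: (ubk (val x)); exists x.
by apply: lek => _ [x Xx <-]; apply: uby.
Qed.

(** The supremum formed in [Q] is compact, so it is also the supremum in [K Q] and must be [k]. *)
Lemma val_K_finlub : finlub_preserving (fun k : K Q => val k).
Proof.
move=> X k finX X0 lubk.
have [|s [lubs _ _]] := (pnqP Q).1 (val @` X); first exact: image_nonempty.
have cs : compact_elt s.
  apply: compact_elt_isLub lubs; first exact: finite_image.
  by move=> _ [x _ <-]; apply: K_compact.
suff -> : k = Sub s (mem_set cs) by [].
by apply: isLub_unique lubk _; apply: isLub_K.
Qed.

Lemma K_msl : multiplicative_semilattice (K Q).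
Proof.
move=> x y; have [|s [lubs lubl lubr]] := (pnqP Q).1 (val @` [set x; y]).
  by exists (val x), x => //; left.
have cs : compact_elt s.
  apply: compact_elt_isLub lubs; first exact/finite_image/finite_set2.
  by move=> _ [z _ <-]; apply: K_compact.
exists (Sub s (mem_set cs)); split=> [|a|a]; apply: isLub_K => //.
  by move: (lubl (val a)); rewrite !image_setU !image_set1.
by move: (lubr (val a)); rewrite !image_setU !image_set1.
Qed.

Lemma isLub_K_below q : [set k : K Q | val k <= q] !=set0 /\
  isLub [set val k | k in [set k : K Q | val k <= q]] q.
Proof.
have [X cX lubX] := (pnqP Q).2.1 q.
have [[k [ck kq]] [ubq leq_]] := isLub_compact_below cX lubX.
split; first by exists (Sub k (mem_set ck)).
split=> [_ [x xq <-]//|b ubb]; apply: leq_ => x [cx xq].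
by apply: ubb; exists (Sub x (mem_set cx)).
Qed.

Local Notation KM := (Msl K_msl).

(** Two compact elements below [q] have their supremum in [Q] below [q], and this is also their
    supremum in [K Q]. *)
Lemma ideal_K_below q : ideal [set k : KM | val k <= q].
Proof.
split=> [|x y /= xq yx]; last by apply: le_trans xq.
apply: directed2; first by case: (isLub_K_below q).
move=> x y /= xq yq; have [s [lubs _ _]] := K_msl x y.
exists s; split; [|by apply: lubs.1; left|by apply: lubs.1; right].
have [||_ les] := val_K_finlub _ _ lubs; first exact: finite_set2.
  by exists x; left.
by apply: les => _ [z [->|->] <-].
Qed.

Lemma Idl_K_sup_exists (I : Idl KM) :
  exists q, isLub [set val k | k in val I] q.
Proof.
have [|q [lubq _ _]] := (pnqP Q).1 [set val k | k in val I]; last by exists q.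
exact/image_nonempty/Idl_nonempty.
Qed.

Definition Idl_sup (I : Idl KM) : Q := sval (cid (Idl_K_sup_exists I)).

Lemma isLub_Idl_sup (I : Idl KM) : isLub [set val k | k in val I] (Idl_sup I).
Proof. exact: svalP (cid _). Qed.

Lemma Idl_sup_leP (I : Idl KM) q :
  reflect (forall k, val I k -> val k <= q) (Idl_sup I <= q).
Proof.
have [ubI leI] := isLub_Idl_sup I.
apply: (iffP idP) => [Iq k Ik|Iq]; last by apply: leI => _ [k Ik <-]; apply: Iq.
by apply: le_trans Iq; apply: ubI; exists k.
Qed.

(** Since [I] is directed, a compact element below its supremum lies below a member of [I], hence in
    [I]. This recovers [I] from its supremum. *)
Lemma le_Idl_sup (I : Idl KM) k : (val k <= Idl_sup I) = `[< val I k >].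
Proof.
apply/idP/asboolP => [kI|Ik]; last first.
  by apply: (isLub_Idl_sup I).1; exists k.
have [|_ [x Ix <-] kx] := K_compact _ (isLub_Idl_sup I) kI.
  apply: directed2; first exact/image_nonempty/Idl_nonempty.
  move=> _ _ [x Ix <-] [y Iy <-].
  have [u [Iu xu yu]] := directed_bound2 (Idl_ideal I).1 Ix Iy.
  by exists (val u); split=> //; exists u.
exact: (Idl_ideal I).2 kx.
Qed.

Lemma Idl_supM : {morph Idl_sup : I J / I * J}.
Proof.
move=> I J; apply/le_anti/andP; split.
  apply/Idl_sup_leP; apply: ideal_hull_min.
    exact: finlub_closed_preimage val_K_finlub (@down_finlub_closed _ _ _).
  move=> _ [x Ix [y Jy <-]] /=.
  by apply: le_mulg; rewrite le_Idl_sup; apply/asboolP.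
have supl a : isLub [set a * x | x in val @` val J] (a * Idl_sup J).
  have [|s [lubs + _]] := (pnqP Q).1 (val @` val J).
    exact/image_nonempty/Idl_nonempty.
  by rewrite (isLub_unique lubs (isLub_Idl_sup J)).
have supr a : isLub [set x * a | x in val @` val I] (Idl_sup I * a).
  have [|s [lubs _ +]] := (pnqP Q).1 (val @` val I).
    exact/image_nonempty/Idl_nonempty.
  by rewrite (isLub_unique lubs (isLub_Idl_sup I)).
(* Distributing over the supremum of [I], then over that of [J], leaves only products of elements of
   [I] and [J]. *)
apply: (supr _).2 => _ [_ [x Ix <-] <-].
apply: (supl _).2 => _ [_ [y Jy <-] <-].
rewrite (_ : val x * val y = val (x * y)) // le_Idl_sup; apply/asboolP.
by apply: sub_ideal_hull; exists x => //; exists y.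
Qed.

Lemma Idl_sup_isomorphism : omagma_isomorphism Idl_sup.
Proof.
apply: omagma_isomorphism_surj => [|I J|q]; first exact: Idl_supM.
  apply/Idl_sup_leP/Idl_leP => IJ k.
    by move=> /IJ; rewrite le_Idl_sup => /asboolP.
  by move=> /IJ Jk; rewrite le_Idl_sup; apply/asboolP.
(* By precoherence [q] is the supremum of the compact elements below it, so these form its
   preimage. *)
pose I : Idl KM := Sub [set k | val k <= q] (mem_set (ideal_K_below q)).
exists I; exact: isLub_unique (isLub_Idl_sup I) (isLub_K_below q).2.
Qed.

End CompactTheory.

(** * The functors and the equivalence of categories *)

Section Functoriality.
Variable d : Order.disp_t.

(** A finite supremum in [K Q] is one in [Q]; [f] preserves it, and the inclusion of [K Q'] reflects
    it. *)
Lemma K_map_msl (Q Q' : pnq d) (f : pnq_hom Q Q') : msl_morphism (K_map f).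
Proof.
have [fM fS _] := pnq_funP f.
split=> [x y|X k finX X0 lubk]; first exact/val_inj/fM.
apply: isLub_K; rewrite image_comp -(image_comp (fun k : K Q => val k) f).
apply: fS; first exact: image_nonempty.
exact: val_K_finlub.
Qed.

Lemma Idl_map_leP (M M' : msl d) (g : msl_hom M M') (I : Idl M) (J : Idl M') :
  reflect (forall x, val I x -> val J (g x)) (Idl_map g I <= J).
Proof.
apply: (iffP (Idl_leP _ _)) => [gIJ x Ix|gIJ].
  by apply/gIJ/sub_ideal_hull; exists x.
apply: ideal_hull_min; first exact: Idl_finlub_closed.
by move=> _ [x Ix <-]; apply: gIJ.
Qed.

Lemma Idl_map_mem (M M' : msl d) (g : msl_hom M M') (I : Idl M) x :
  val I x -> val (Idl_map g I) (g x).
Proof. by move=> Ix; apply: sub_ideal_hull; exists x. Qed.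

Lemma Idl_map_down (M M' : msl d) (g : msl_hom M M') (x : M) :
  Idl_map g (down x) = down (g x).
Proof.
apply/le_anti/andP; split; last first.
  by apply/down_leP/Idl_map_mem; rewrite /= lexx.
apply/Idl_map_leP => y /= yx.
exact: finlub_preserving_homo (msl_funP g).2 _ _ yx.
Qed.

Lemma Idl_map_pnq (M M' : msl d) (g : msl_hom M M') : pnq_morphism (Idl_map g).
Proof.
have [gM gS] := msl_funP g.
(* This lets inclusions out of a product or a supremum be tested on generators. *)
have cpre (B : Idl M') : finlub_closed (g @^-1` val B).
  exact: finlub_closed_preimage gS (@Idl_finlub_closed _ _ B).
split=> [I J|X I X0 lubI|I /compact_Idl_down[x ->]].
- apply/le_anti/andP; split.
    apply/Idl_map_leP; apply: ideal_hull_min; first exact: cpre.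
    move=> _ [x Ix [y Jy <-]] /=; rewrite gM; apply: sub_ideal_hull.
    by exists (g x); [|exists (g y)]; try exact: Idl_map_mem.
  apply/Idl_mul_leP; apply: ideal_hull_mul_min; first exact: Idl_finlub_closed.
  move=> _ _ [x Ix <-] [y Jy <-]; rewrite -gM; apply: Idl_map_mem.
  by apply: sub_ideal_hull; exists x => //; exists y.
- split=> [_ [J XJ <-]|B ubB].
    apply/Idl_map_leP => x Jx; apply: Idl_map_mem.
    by have /Idl_leP := lubI.1 _ XJ; apply.
  apply/Idl_map_leP; rewrite (isLub_IdlE X0 lubI); apply: ideal_hull_min.
    exact: cpre.
  move=> x [J XJ Jx].
  have /Idl_map_leP : Idl_map g J <= B by apply: ubB; exists J.
  exact.
- by rewrite Idl_map_down; apply: compact_down.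
Qed.

Definition IdlO (M : msl d) : pnq d := Pnq (Idl_pnq M).
Definition KO (Q : pnq d) : msl d := Msl (@K_msl d Q).

Definition KM (Q Q' : pnq d) (f : pnq_hom Q Q') : msl_hom (KO Q) (KO Q') :=
  @MslHom d (KO Q) (KO Q') (K_map f) (K_map_msl f).
Definition IdlM (M M' : msl d) (g : msl_hom M M') :
    pnq_hom (IdlO M) (IdlO M') :=
  @PnqHom d (IdlO M) (IdlO M') (Idl_map g) (Idl_map_pnq g).

Lemma K_is_functor : is_functor (C := pnq_category d) (D := msl_category d) KM.
Proof. by split=> [Q|Q1 Q2 Q3 g f]; apply: msl_hom_eq => k; apply: val_inj. Qed.

Lemma Idl_is_functor :
  is_functor (C := msl_category d) (D := pnq_category d) IdlM.
Proof.
split=> [M|M1 M2 M3 g f]; apply: pnq_hom_eq => I; apply/le_anti/andP; split.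
- by apply/Idl_map_leP.
- by apply/Idl_leP => x Ix; apply: (Idl_map_mem (msl_id M)).
- by apply/Idl_map_leP => x Ix; do 2!apply: Idl_map_mem.
- apply/Idl_map_leP; apply: ideal_hull_min.
    exact: finlub_closed_preimage (msl_funP g).2 (@Idl_finlub_closed _ _ _).
  by move=> _ [x Ix <-]; apply: (Idl_map_mem (msl_comp g f)).
Qed.

(** The isomorphisms are the supremum map on ideals of compact elements and the principal ideal map;
    what remains is naturality. *)
Lemma K_Idl_equivalence :
  category_equivalence (Functor K_is_functor) (Functor Idl_is_functor).
Proof.
split.
  exists (fun Q => PnqHom (omagma_isomorphism_pnq (Q := IdlO (KO Q))
    (@Idl_sup_isomorphism d Q))).
  split=> [Q Q' f|Q]; last exact/pnq_isomorphism/Idl_sup_isomorphism.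
  apply: pnq_hom_eq => I /=.
  have [_ fS _] := pnq_funP f.
  (* Both sides of the square are suprema of the values of [f] on [I], so they are compared on these
     generators. *)
  have lubf := fS _ _ (image_nonempty _ (Idl_nonempty I)) (isLub_Idl_sup I).
  apply/le_anti/andP; split.
    apply/Idl_sup_leP; apply: ideal_hull_min.
      exact: finlub_closed_preimage (@val_K_finlub d Q')
        (@down_finlub_closed _ _ _).
    move=> _ [k Ik <-]; apply: lubf.1; exists (val k) => //; by exists k.
  apply: lubf.2 => _ [_ [k Ik <-] <-].
  rewrite -[f _]/(val (K_map f k)) le_Idl_sup; apply/asboolP.
  exact: (@Idl_map_mem _ _ (KM f)).
(* Principal ideals give a map out of [M], opposite to the direction required here. *)
apply: naturally_isomorphic_sym.
exists (fun M => MslHom (omagma_isomorphism_msl (M' := KO (IdlO M))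
  (@down_K_isomorphism d M))).
split=> [M M' g|M]; last exact/msl_isomorphism/down_K_isomorphism.
by apply: msl_hom_eq => x; apply/val_inj; rewrite /= Idl_map_down.
Qed.

End Functoriality.

Theorem theorem7p4 (d : Order.disp_t) :
  exists (Idl_pnq : forall M : msl d,
            near_prequantale (Idl M) /\ precoherent (Idl M))
         (K_msl : forall Q : pnq d, multiplicative_semilattice (K Q)),
  let IdlO (M : msl d) : pnq d := Pnq (Idl_pnq M) in
  let KO (Q : pnq d) : msl d := Msl (K_msl Q) in
  (forall M : msl d,
     exists phi : M -> K (IdlO M),
       (forall x : M, val (val (phi x)) = [set y | y <= x]) /\
       omagma_isomorphism phi) /\
  (forall Q : pnq d,
     exists psi : Idl (KO Q) -> Q,
       (forall I : Idl (KO Q),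
          isLub [set val x | x in (val I : set (K Q))] (psi I)) /\
       omagma_isomorphism psi) /\
  exists (K_map_msl : forall (Q Q' : pnq d) (f : pnq_hom Q Q'),
            msl_morphism (K_map f))
         (Idl_map_pnq : forall (M M' : msl d) (g : msl_hom M M'),
            pnq_morphism (Idl_map g)),
  let KM (Q Q' : pnq d) (f : pnq_hom Q Q') : msl_hom (KO Q) (KO Q') :=
    @MslHom d (KO Q) (KO Q') (K_map f) (K_map_msl Q Q' f) in
  let IdlM (M M' : msl d) (g : msl_hom M M') : pnq_hom (IdlO M) (IdlO M') :=
    @PnqHom d (IdlO M) (IdlO M') (Idl_map g) (Idl_map_pnq M M' g) in
  exists (K_functor : is_functor (C := pnq_category d) (D := msl_category d) KM)
         (Idl_functor :
            is_functor (C := msl_category d) (D := pnq_category d) IdlM),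
    category_equivalence (Functor K_functor) (Functor Idl_functor).
Proof.
exists (@Idl_pnq d), (@K_msl d) => /=; split.
  by move=> M; exists (@down_K d M); split=> //; exact: down_K_isomorphism.
split.
  move=> Q; exists (@Idl_sup d Q); split; first exact: isLub_Idl_sup.
  exact: Idl_sup_isomorphism.
exists (@K_map_msl d), (@Idl_map_pnq d) => /=.
exists (K_is_functor d), (Idl_is_functor d); exact: K_Idl_equivalence.
Qed.
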